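(* For each $k\in\mathbb N=\{1,2,\dots\}$ define an infinite matrix $\alpha^{(k)}=(\alpha^{(k)}_{ij})_{i,j\in\mathbb N}$ by $\alpha^{(k)}_{ij}=j^k$ if $i<k$ and $\alpha^{(k)}_{ij}=i^k$ if $i\ge k$. Fix a bijection $\varphi\colon\mathbb N^2\to\mathbb N$ such that $\varphi(i,j)<\varphi(i,j+1)$ for all $i,j\in\mathbb N$. For each $k$ define a sequence $p^{(k)}=(p^{(k)}_n)_{n\in\mathbb N}$ by $p^{(k)}_n=\alpha^{(k)}_{\varphi^{-1}(n)}$, and set $P=\{p^{(k)}:k\in\mathbb N\}$. Then the algebra $A(P)$ has a locally bounded approximate identity, but does not have a bounded approximate identity.
   Context: The Köthe sequence space is $\lambda(P)=\{a=(a_i)_{i\in\mathbb N}\in\mathbb C^{\mathbb N}: \|a\|_p=\sum_i|a_i|p_i<\infty\ \forall p\in P\}$, with the locally convex topology generated by the seminorms $\|\cdot\|_p$, $p\in P$. Let $e_i=(0,\dots,0,1,0,\dots)$ with $1$ in the $i$th slot. When all $p_i\ge1$ (as is the case here), there is a unique continuous product on $\lambda(P)$ with $e_ie_j=e_{\min\{i,j\}}$ for all $i,j\in\mathbb N$; $A(P)$ denotes $\lambda(P)$ with this product, a commutative algebra, complete and with topology generated by submultiplicative seminorms (Fréchet, as $P$ is countable). A topological algebra $A$ has a (two-sided) locally bounded approximate identity if for each $0$-neighborhood $U\subset A$ there exists $C>0$ such that for each finite $F\subset A$ there exists $b\in CU$ with $a-ab\in U$ and $a-ba\in U$ for all $a\in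 F$. A bounded approximate identity in $A$ is a net $(e_\alpha)$ with $\{e_\alpha\}$ bounded and $ae_\alpha\to a$, $e_\alpha a\to a$ for all $a\in A$. *)

(* Defs.v *)
From HB Require Import structures.
From mathcomp Require Import all_boot all_order all_algebra.
From mathcomp Require Import complex.
From mathcomp Require Import all_classical reals ereal topology normedtype.
From mathcomp Require Import convex sequences.
From mathcomp Require Import ring lra zify.

Set Implicit Arguments.
Unset Strict Implicit.
Unset Printing Implicit Defensive.

Import Order.TTheory GRing.Theory Num.Theory.
Import numFieldNormedType.Exports.

Local Open Scope classical_set_scope.
Local Open Scope ring_scope.
Local Open Scope convex_scope.

(* Topological algebras are not assumed to be unital. *)
HB.mixin Record TopologicalLmodule_isTopAlgebra (K : numFieldType) A
    & TopologicalLmodule K A := {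
  tmul : A -> A -> A ;
  tmulA : associative tmul ;
  tmulDl : left_distributive tmul +%R ;
  tmulDr : right_distributive tmul +%R ;
  tmulZl : forall (c : K) a b, tmul (c *: a) b = c *: tmul a b ;
  tmulZr : forall (c : K) a b, tmul a (c *: b) = c *: tmul a b ;
  tmul_continuous : continuous (fun ab : A * A => tmul ab.1 ab.2) ;
}.

#[short(type="topAlgType")]
HB.structure Definition TopAlgebra (K : numFieldType) :=
  {A of TopologicalLmodule K A & TopologicalLmodule_isTopAlgebra K A}.

Section ApproximateIdentities.
Context {K : numFieldType}.

(* The scalars C and r below are positive reals even if K is R[i], because
   in a numFieldType 0 < C entails that C is real. *)

Definition has_locally_bounded_approximate_identity (A : topAlgType K) :=
  forall U : set A, nbhs 0 U -> exists2 C : K, 0 < C &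
    forall F : set A, finite_set F ->
      exists2 b : A, ( *:%R C @` U) b &
        forall a, F a -> U (a - tmul a b) /\ U (a - tmul b a).

(* von Neumann boundedness; [bounded_set] is limited to normed modules *)
Definition tvs_bounded (A : topologicalLmodType K) (B : set A) :=
  forall U : set A, nbhs 0 U -> exists2 r : K, 0 < r & B `<=` *:%R r @` U.

Record directed (I : Type) (le : I -> I -> Prop) : Prop := Directed {
  directed_inhabited : exists i : I, True ;
  directed_refl : forall i, le i i ;
  directed_trans : forall j i k, le i j -> le j k -> le i k ;
  directed_ub : forall i j, exists k, le i k /\ le j k
}.

Definition net_filter (I : Type) (le : I -> I -> Prop) : set_system I :=
  filter_from [set: I] (fun i => [set j | le i j]).

Definition has_bounded_approximate_identity (A : topAlgType K) :=
  exists (I : Type) (le : I -> I -> Prop) (e : I -> A),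
    [/\ directed le,
        tvs_bounded (range e) &
        forall a : A,
          tmul a (e i) @[i --> net_filter le] --> a /\
          tmul (e i) a @[i --> net_filter le] --> a].

End ApproximateIdentities.

Notation normc := ComplexField.Normc.normc.

(* The topology on λ(P) is generated by finite families of seminorms, so P need
   not be directed; only the case p_n >= 1, in which λ(P) is an algebra, is
   considered. Sequences are indexed from 0. *)
Record koethe_set (R : realType) := KoetheSet {
  weights :> set (nat -> R) ;
  weights_neq0 : weights !=set0 ;
  weights_ge1 : forall p, weights p -> forall n, 1 <= p n
}.

Section KoetheSpace.
Context {R : realType}.
Implicit Types (P : koethe_set R) (p : nat -> R) (a b : nat -> R[i]).

Definition weighted_norm p a : \bar R :=
  (\sum_(n <oo) (normc (a n) * p n)%:E)%E.

Definition koethe_mem P : {pred nat -> R[i]} :=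
  fun a => `[< forall p, weights P p -> (weighted_norm p a < +oo)%E >].

Lemma koethe_memP P a :
  reflect (forall p, weights P p -> (weighted_norm p a < +oo)%E) (a \in koethe_mem P).
Proof. exact: asboolP. Qed.

Lemma normc_ge0 (z : R[i]) : 0 <= normc z.
Proof. by case: z => x y; exact: sqrtr_ge0. Qed.

Lemma weight_ge0 P p n : weights P p -> 0 <= p n.
Proof. by move=> /weights_ge1 /(_ n); apply: le_trans. Qed.

Lemma weighted_ge0 P p a n : weights P p -> (0 <= (normc (a n) * p n)%:E)%E.
Proof. by move=> Pp; rewrite lee_fin mulr_ge0 ?normc_ge0 ?(weight_ge0 _ Pp). Qed.

Lemma weighted_norm_ge0 P p a : weights P p -> (0 <= weighted_norm p a)%E.
Proof. by move=> Pp; apply: nneseries_ge0 => n _ _; exact: weighted_ge0 Pp. Qed.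

Lemma weighted_norm0 p : weighted_norm p 0 = 0%E.
Proof. by apply: eseries0 => n _ _; rewrite ComplexField.Normc.normc0 mul0r. Qed.

Lemma weighted_normD P p a b : weights P p ->
  (weighted_norm p (a + b)%R <= weighted_norm p a + weighted_norm p b)%E.
Proof.
move=> Pp; rewrite /weighted_norm -nneseriesD; last 2 first.
- by move=> n _ _; exact: weighted_ge0 Pp.
- by move=> n _ _; exact: weighted_ge0 Pp.
apply: lee_nneseries => [n _ _|n _]; first exact: weighted_ge0 Pp.
rewrite -EFinD lee_fin -mulrDl ler_wpM2r ?(weight_ge0 _ Pp)//.
exact: le_normcD.
Qed.

Lemma weighted_normZ P p (c : R[i]) a : weights P p ->
  weighted_norm p (c *: a) = ((normc c)%:E * weighted_norm p a)%E.
Proof.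
move=> Pp; rewrite /weighted_norm -nneseriesZl; last first.
  by move=> n _; exact: weighted_ge0 Pp.
apply: eq_eseriesr => n _ /=.
by rewrite -EFinM mulrA -ComplexField.Normc.normcM.
Qed.

Lemma weighted_normN p a : weighted_norm p (- a) = weighted_norm p a.
Proof. by apply: eq_eseriesr => n _ /=; rewrite -[in RHS]normcN. Qed.

Lemma koethe_mem_submod P : submod_closed (koethe_mem P).
Proof.
split=> [|c a b /koethe_memP Pa /koethe_memP Pb]; apply/koethe_memP => p Pp.
  by rewrite weighted_norm0.
rewrite (le_lt_trans (weighted_normD _ _ Pp))// lte_add_pinfty ?Pb//.
by rewrite (weighted_normZ _ _ Pp) lte_mul_pinfty ?lee_fin ?normc_ge0 ?Pa.
Qed.

HB.instance Definition _ P :=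
  GRing.isSubmodClosed.Build R[i] (nat -> R[i]) (koethe_mem P)
    (koethe_mem_submod P).

(* the space λ(P) *)
Record koethe P := Koethe {
  koethe_seq :> nat -> R[i] ;
  _ : koethe_seq \in koethe_mem P
}.

HB.instance Definition _ P := [isSub of koethe P for @koethe_seq P].
HB.instance Definition _ P := [Choice of koethe P by <:].
HB.instance Definition _ P := [SubChoice_isSubLmodule of koethe P by <:].

End KoetheSpace.

Section KoetheTopology.
Context {R : realType} (P : koethe_set R).
Local Notation E := (koethe P).
Implicit Types (a b c : E) (F : set (nat -> R)).

(* the seminorms of λ(P); their values are finite by [koethe_norm_lty] *)
Definition koethe_norm (p : nat -> R) (a : E) : R :=
  fine (weighted_norm p a).

Lemma koethe_norm_lty p a : weights P p -> (weighted_norm p a < +oo)%E.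
Proof. by case: a => a /= /koethe_memP; apply. Qed.

Lemma koethe_normE p a : weights P p -> (koethe_norm p a)%:E = weighted_norm p a.
Proof.
move=> Pp; rewrite fineK// ge0_fin_numE ?koethe_norm_lty//.
exact: weighted_norm_ge0 Pp.
Qed.

Lemma koethe_norm_ge0 p a : weights P p -> 0 <= koethe_norm p a.
Proof. by move=> Pp; rewrite -lee_fin koethe_normE// (weighted_norm_ge0 _ Pp). Qed.

Lemma koethe_norm0 p : koethe_norm p 0 = 0.
Proof. by rewrite /koethe_norm weighted_norm0. Qed.

Lemma koethe_normD p a b : weights P p ->
  koethe_norm p (a + b) <= koethe_norm p a + koethe_norm p b.
Proof.
by move=> Pp; rewrite -lee_fin EFinD !koethe_normE//; exact: weighted_normD Pp.
Qed.

Lemma koethe_normZ p (c : R[i]) a : weights P p ->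
  koethe_norm p (c *: a) = normc c * koethe_norm p a.
Proof.
move=> Pp; apply: EFin_inj; rewrite EFinM !koethe_normE//.
exact: weighted_normZ Pp.
Qed.

Lemma koethe_normN p a : koethe_norm p (- a) = koethe_norm p a.
Proof. by rewrite /koethe_norm weighted_normN. Qed.

Lemma koethe_distC p a b : koethe_norm p (a - b) = koethe_norm p (b - a).
Proof. by rewrite -koethe_normN opprB. Qed.

(* basic neighborhoods of the locally convex topology generated by the
   seminorms [koethe_norm p], p in P *)
Definition koethe_ball (a : E) (Fe : set (nat -> R) * R) : set E :=
  [set b | forall p, Fe.1 p -> koethe_norm p (b - a) < Fe.2].

Definition koethe_radii : set (set (nat -> R) * R) :=
  [set Fe | [/\ finite_set Fe.1, Fe.1 `<=` weights P & 0 < Fe.2]].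

Definition koethe_nbhs (a : E) : set_system E :=
  filter_from koethe_radii (koethe_ball a).

HB.instance Definition _ := hasNbhs.Build E koethe_nbhs.

Lemma koethe_nbhs_filter a : ProperFilter (nbhs a).
Proof.
apply: filter_from_proper; last first.
  by move=> [F e] [_ FP e0]; exists a => p /=; rewrite subrr koethe_norm0.
apply: filter_from_filter.
  by exists (set0, 1); split => //=; exact: ltr01.
move=> [F e] [G f] [/= Ffin FP e0] [/= Gfin GP f0].
exists (F `|` G, Num.min e f); first split => /=.
- by rewrite finite_setU.
- by move=> p [/FP|/GP].
- by rewrite lt_min e0.
- move=> b /= ab; split=> p Hp /=.
  + by apply: lt_le_trans (ab p (or_introl Hp)) _; rewrite ge_min lexx.
  + by apply: lt_le_trans (ab p (or_intror Hp)) _; rewrite ge_min lexx orbT.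
Qed.

Lemma koethe_nbhs_singleton a (U : set E) : nbhs a U -> U a.
Proof.
by move=> [[F e] [_ _ e0]]; apply => p _ /=; rewrite subrr koethe_norm0.
Qed.

(* room left around a point of a basic neighborhood *)
Lemma koethe_ball_room F (e : R) a b : finite_set F -> F `<=` weights P -> 0 < e ->
  koethe_ball a (F, e) b ->
  exists2 d, 0 < d & koethe_ball b (F, d) `<=` koethe_ball a (F, e).
Proof.
move=> Ffin FP e0 ab.
have [d d0 dle] : exists2 d, 0 < d &
    forall p, F p -> koethe_norm p (b - a) + d <= e.
  move: Ffin ab {FP} => /finite_seqP[s ->] /= ab.
  elim: s ab => [|q s IH] ab; first by exists 1.
  have [|d d0 IHd] := IH; first by move=> p ps; apply: ab; rewrite /= inE ps orbT.
  have /= bq := ab q (mem_head _ _).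
  exists (Num.min d (e - koethe_norm q (b - a))).
    by rewrite lt_min d0 subr_gt0.
  move=> p /=; rewrite inE => /orP[/eqP->|/IHd].
    by rewrite -lerBrDl ge_min lexx orbT.
  by apply: le_trans; rewrite lerD2l ge_min lexx.
exists d => // c bc p Fp /=.
have -> : c - a = (c - b) + (b - a) by rewrite addrA subrK.
apply: le_lt_trans (koethe_normD _ _ (FP _ Fp)) _.
by apply: lt_le_trans (dle _ Fp); rewrite addrC ltrD2l; exact: bc.
Qed.

Lemma koethe_nbhs_nbhs a (U : set E) : nbhs a U -> nbhs a (nbhs^~ U).
Proof.
move=> [[F e] [/= Ffin FP e0] aU]; exists (F, e) => // b ab.
have [d d0 dU] := koethe_ball_room Ffin FP e0 ab.
by exists (F, d) => //; exact: subset_trans aU.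
Qed.

HB.instance Definition _ := Nbhs_isNbhsTopological.Build E
  koethe_nbhs_filter koethe_nbhs_singleton koethe_nbhs_nbhs.

Lemma koethe_ball_open F (e : R) a : finite_set F -> F `<=` weights P -> 0 < e ->
  open (koethe_ball a (F, e)).
Proof.
move=> Ffin FP e0; rewrite openE => b ab.
by have [d d0 db] := koethe_ball_room Ffin FP e0 ab; exists (F, d).
Qed.

Lemma koethe_add_continuous : continuous (fun x : E * E => x.1 + x.2).
Proof.
move=> [a b] U [[F e] [/= Ffin FP e0] abU].
exists (koethe_ball a (F, e / 2), koethe_ball b (F, e / 2)).
  by split; exists (F, e / 2) => //; split => //=; exact: divr_gt0.
move=> [c d] /= [ac bd]; apply: abU => p Fp /=.
rewrite opprD addrACA; apply: le_lt_trans (koethe_normD _ _ (FP _ Fp)) _.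
by rewrite [e]splitr; exact: ltrD (ac p Fp) (bd p Fp).
Qed.

Lemma ltr_normc (z : R[i]) (e : R) : (`|z| < (e%:C)%C) = (normc z < e).
Proof. by rewrite ltcR. Qed.

Lemma koethe_scale_continuous :
  continuous (fun z : R[i]^o * E => z.1 *: z.2).
Proof.
move=> [k a] U [[F e] [/= Ffin FP e0] kaU].
have [M M0 Ma] : exists2 M, 0 < M & forall p, F p -> koethe_norm p a <= M.
  move: Ffin {kaU FP} => /finite_seqP[s ->].
  elim: s => [|q s [M M0 IH]]; first by exists 1.
  exists (Num.max M (koethe_norm q a)); first by rewrite lt_max M0.
  move=> p /=; rewrite inE => /orP[/eqP->|/IH]; first by rewrite le_max lexx orbT.
  by move=> h; rewrite le_max h.
pose r := Num.min 1 (e / 2 / M).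
have r0 : 0 < r by rewrite lt_min ltr01 !divr_gt0.
pose d := e / 2 / (normc k + 1).
have k1 : 0 < normc k + 1 by rewrite ltr_wpDl ?normc_ge0.
have d0 : 0 < d by rewrite !divr_gt0.
exists (ball (k : R[i]^o) (r%:C)%C, koethe_ball a (F, d)).
  split; last by exists (F, d).
  by apply: nbhsx_ballx; rewrite ltcR.
move=> [l b] /= [kl ab]; apply: kaU => p Fp /=.
have {}kl : normc (l - k) < r.
  by move: kl; rewrite -ball_normE /ball_/= distrC ltr_normc.
have {ab} /= ab := ab p Fp.
have Pp := FP _ Fp.
have -> : l *: b - k *: a = l *: (b - a) + (l - k) *: a.
  by rewrite scalerBr scalerBl addrA subrK.
apply: le_lt_trans (koethe_normD _ _ Pp) _; rewrite !koethe_normZ//.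
have l1 : normc l <= normc k + 1.
  rewrite -[l](subrK k); apply: le_trans (le_normcD _ _) _.
  rewrite addrC lerD2l; apply: le_trans (ltW kl) _.
  by rewrite /r ge_min lexx.
rewrite [e]splitr; apply: ltr_leD.
  apply: le_lt_trans (ler_wpM2r (koethe_norm_ge0 _ Pp) l1) _.
  by rewrite mulrC -ltr_pdivlMr.
apply: le_trans (ler_wpM2l (normc_ge0 _) (Ma _ Fp)) _.
rewrite -ler_pdivlMr//; apply: le_trans (ltW kl) _.
by rewrite /r ge_min lexx orbT.
Qed.

Lemma koethe_ball_convex F (e : R) a : F `<=` weights P -> convex_set (koethe_ball a (F, e)).
Proof.
move=> FP; apply/convex_setW => x y; rewrite !inE => ax ay k k0 k1.
rewrite inE => p Fp /=; have Pp := FP _ Fp.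
have -> : x <| k |> y - a = k%:num *: (x - a) + (1 - k%:num) *: (y - a).
  rewrite !scalerBr addrACA -opprD -scalerDl addrCA subrr addr0 scale1r.
  by [].
apply: le_lt_trans (koethe_normD _ _ Pp) _; rewrite !koethe_normZ//.
have kE : normc k%:num = complex.Re k%:num.
  by rewrite -[LHS]/(complex.Re `|k%:num|) (ger0_norm (ltW k0)).
have kE' : normc (1 - k%:num) = 1 - complex.Re k%:num.
  rewrite -[LHS]/(complex.Re `|1 - k%:num|) ger0_norm ?subr_ge0 ?(ltW k1)//.
  by case: (k%:num).
have [k0' k1'] : 0 < complex.Re k%:num /\ complex.Re k%:num < 1.
  by move: k0 k1; rewrite !ltcE /= => /andP[_ ->] /andP[_ ->].
rewrite kE kE'; have /= {}ax := ax p Fp; have /= {}ay := ay p Fp.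
by nra.
Qed.

Lemma koethe_locally_convex :
  exists2 B : set_system E, (forall U, U \in B -> convex_set U) & basis B.
Proof.
exists [set B | exists a F e, [/\ finite_set F, F `<=` weights P, 0 < e &
                                  B = koethe_ball a (F, e)]].
  by move=> B /[!inE] -[a [F [e [_ FP _ ->]]]]; exact: koethe_ball_convex.
split=> [B [a [F [e [? ? ? ->]]]]|a U]; first exact: koethe_ball_open.
move=> [[F e] [/= Ffin FP e0] aU]; exists (koethe_ball a (F, e)) => //=.
split; first by exists a, F, e.
by move=> p _ /=; rewrite subrr koethe_norm0.
Qed.

HB.instance Definition _ := PreTopologicalLmod_isTvs.Build R[i] E
  koethe_add_continuous koethe_scale_continuous koethe_locally_convex.
HB.instance Definition _ :=
  PreTopologicalNmodule_isTopologicalNmodule.Build E koethe_add_continuous.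
HB.instance Definition _ :=
  TopologicalNmodule_isTopologicalLmodule.Build R[i] E koethe_scale_continuous.
HB.instance Definition _ := Uniform_isTvs.Build R[i] E koethe_locally_convex.

End KoetheTopology.

Section AbsolutelySummable.
Context {R : realType}.
Implicit Types (u v : nat -> R[i]) (M : R).

Definition abs_summable_by u M :=
  forall N, \sum_(0 <= k < N) normc (u k) <= M.

(* computed componentwise, since R[i] is not a complete space in the library *)
Definition csum u : R[i] :=
  Complex (limn (series (fun k => complex.Re (u k))))
          (limn (series (fun k => complex.Im (u k)))).

Lemma ler_Re_normc (z : R[i]) : `|complex.Re z| <= normc z.
Proof.
case: z => x y /=; rewrite -sqrtr_sqr ler_sqrt ?lerDl ?sqr_ge0//.
by rewrite addr_ge0 ?sqr_ge0.
Qed.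

Lemma ler_Im_normc (z : R[i]) : `|complex.Im z| <= normc z.
Proof.
case: z => x y /=; rewrite -sqrtr_sqr ler_sqrt ?lerDr ?sqr_ge0//.
by rewrite addr_ge0 ?sqr_ge0.
Qed.

Lemma ler_normc_ReIm (z : R[i]) :
  normc z <= `|complex.Re z| + `|complex.Im z|.
Proof.
case: z => x y /=; have xy0 : 0 <= `|x| + `|y| by rewrite addr_ge0.
rewrite -[leRHS](ger0_norm xy0) -sqrtr_sqr ler_sqrt ?sqr_ge0//.
rewrite sqrrD -!normrX !(ger0_norm (sqr_ge0 _)).
by rewrite addrAC lerDl mulrn_wge0// mulr_ge0.
Qed.

Lemma bounded_series_cvg (f : nat -> R) M :
  (forall N, \sum_(0 <= k < N) `|f k| <= M) -> cvgn (series f).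
Proof.
move=> fM; apply: normed_cvg.
apply: nondecreasing_is_cvgn.
  by apply/nondecreasing_seqP => n /=; rewrite seriesSr lerDl.
by exists M => _ [n _ <-]; exact: fM.
Qed.

Lemma bounded_series_lim (f : nat -> R) M :
  (forall N, \sum_(0 <= k < N) `|f k| <= M) -> `|limn (series f)| <= M.
Proof.
move=> fM; have /cvg_norm cf := bounded_series_cvg fM.
rewrite -(cvg_lim _ cf)//; apply: limr_le; first by apply/cvg_ex; eexists; exact: cf.
apply: nearW => n; apply: le_trans (ler_norm_sum _ _ _) _; exact: fM.
Qed.

Lemma abs_summable_Re u M : abs_summable_by u M ->
  forall N, \sum_(0 <= k < N) `|complex.Re (u k)| <= M.
Proof.
by move=> uM N; apply: le_trans (uM N); apply: ler_sum => k _; exact: ler_Re_normc.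
Qed.

Lemma abs_summable_Im u M : abs_summable_by u M ->
  forall N, \sum_(0 <= k < N) `|complex.Im (u k)| <= M.
Proof.
by move=> uM N; apply: le_trans (uM N); apply: ler_sum => k _; exact: ler_Im_normc.
Qed.

Lemma normc_csum u M : abs_summable_by u M -> normc (csum u) <= 2 * M.
Proof.
move=> uM; apply: le_trans (ler_normc_ReIm _) _; rewrite mulr_natl mulr2n.
by apply: lerD; [exact: bounded_series_lim (abs_summable_Re uM)
  |exact: bounded_series_lim (abs_summable_Im uM)].
Qed.

Lemma csumD u v M M' : abs_summable_by u M -> abs_summable_by v M' ->
  csum (u + v) = csum u + csum v.
Proof.
move=> uM vM'; apply/eqP; rewrite eq_complex /=; apply/andP; split; apply/eqP.
- have cu := bounded_series_cvg (abs_summable_Re uM).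
  have cv := bounded_series_cvg (abs_summable_Re vM').
  apply/cvg_lim => //; rewrite [X in X @ _ --> _](_ : _ = fun n =>
    series (fun k => complex.Re (u k)) n + series (fun k => complex.Re (v k)) n).
    exact: cvgD.
  apply/funext => n; rewrite /series /= -[RHS]big_split /=; apply: eq_bigr => k _.
  by rewrite -[(u + v) k]/(u k + v k); case: (u k) (v k) => ? ? [].
- have cu := bounded_series_cvg (abs_summable_Im uM).
  have cv := bounded_series_cvg (abs_summable_Im vM').
  apply/cvg_lim => //; rewrite [X in X @ _ --> _](_ : _ = fun n =>
    series (fun k => complex.Im (u k)) n + series (fun k => complex.Im (v k)) n).
    exact: cvgD.
  apply/funext => n; rewrite /series /= -[RHS]big_split /=; apply: eq_bigr => k _.
  by rewrite -[(u + v) k]/(u k + v k); case: (u k) (v k) => ? ? [].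
Qed.

Lemma csumZ u M (c : R[i]) : abs_summable_by u M -> csum (c *: u) = c * csum u.
Proof.
move=> uM; have cr := bounded_series_cvg (abs_summable_Re uM).
have ci := bounded_series_cvg (abs_summable_Im uM).
case: c => x y; apply/eqP; rewrite eq_complex /=; apply/andP; split; apply/eqP;
  apply/cvg_lim => //.
- rewrite [X in X @ _ --> _](_ : _ = fun n =>
    x * series (fun k => complex.Re (u k)) n -
    y * series (fun k => complex.Im (u k)) n).
    by apply: cvgB; apply: cvgMr.
  apply/funext => n; rewrite /series /= !mulr_sumr -sumrB.
  apply: eq_bigr => k _.
  by rewrite -[(_ *: u) k]/(Complex x y * u k); case: (u k).
- rewrite [X in X @ _ --> _](_ : _ = fun n =>
    x * series (fun k => complex.Im (u k)) n +
    y * series (fun k => complex.Re (u k)) n).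
    by apply: cvgD; apply: cvgMr.
  apply/funext => n; rewrite /series /= !mulr_sumr -big_split /=.
  apply: eq_bigr => k _.
  by rewrite -[(_ *: u) k]/(Complex x y * u k); case: (u k).
Qed.

Lemma csum_delta (m : nat) : csum (fun k => (k == m)%:R) = 1.
Proof.
apply/eqP; rewrite eq_complex /=; apply/andP; split; apply/eqP;
  apply/cvg_lim => //; apply: cvg_near_cst; exists m.+1 => // n /= mn.
- rewrite /series /= (bigD1_seq m) ?mem_index_iota ?iota_uniq //= eqxx /=.
  by rewrite big1 ?addr0// => k /negbTE ->.
- by rewrite /series /= big1// => k _; case: (k == m).
Qed.

Lemma csum0 : csum (fun=> 0) = 0.
Proof.
apply/eqP; rewrite eq_complex /=; apply/andP; split; apply/eqP;
  apply/cvg_lim => //; apply: cvg_near_cst; exists 0%N => // n _;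
  by rewrite /series /= big1.
Qed.

End AbsolutelySummable.

Section KoetheProduct.
Context {R : realType} (P : koethe_set R).
Local Notation E := (koethe P).
Implicit Types (a b c : E) (p : nat -> R).

Lemma koethe_partial_le p a N : weights P p ->
  \sum_(0 <= k < N) normc (a k) * p k <= koethe_norm p a.
Proof.
move=> Pp; rewrite -lee_fin koethe_normE// -sumEFin.
by apply: nneseries_lim_ge => n _ _; exact: weighted_ge0 Pp.
Qed.

Lemma koethe_tail_summable p a n : weights P p ->
  abs_summable_by (fun k => a (n + k)%N) (koethe_norm p a).
Proof.
move=> Pp N; apply: le_trans (koethe_partial_le a (n + N) Pp).
have -> : \sum_(0 <= k < N) normc (a (n + k)%N) = \sum_(n <= k < n + N) normc (a k).
  rewrite -{2}[n]add0n big_addn addKn; apply: eq_bigr => k _.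
  by rewrite addnC.
rewrite [leRHS](big_cat_nat _ (n := n)) ?leq_addr//=.
rewrite ler_wpDl//.
  by apply: sumr_ge0 => k _; rewrite -lee_fin (weighted_ge0 _ _ Pp).
apply: ler_sum => k _; rewrite ler_peMr ?normc_ge0//.
exact: weights_ge1 Pp _.
Qed.

(* the sum of the a_k for k >= n *)
Definition koethe_tail n a : R[i] := csum (fun k => a (n + k)%N).

Lemma koethe_tail_bound p a n : weights P p ->
  normc (koethe_tail n a) <= 2 * koethe_norm p a.
Proof. by move=> Pp; apply: normc_csum; exact: koethe_tail_summable. Qed.

Lemma koethe_tailD n a b :
  koethe_tail n (a + b) = koethe_tail n a + koethe_tail n b.
Proof.
have [p Pp] := weights_neq0 P.
exact: csumD (koethe_tail_summable a n Pp) (koethe_tail_summable b n Pp).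
Qed.

Lemma koethe_tailZ n (c : R[i]) a : koethe_tail n (c *: a) = c * koethe_tail n a.
Proof.
have [p Pp] := weights_neq0 P.
exact: csumZ (koethe_tail_summable a n Pp).
Qed.

Lemma koethe_norm_le p (u : nat -> R[i]) a b (x y : R) : weights P p ->
  0 <= x -> 0 <= y ->
  (forall n, normc (u n) <= x * normc (a n) + y * normc (b n)) ->
  (weighted_norm p u <= (x * koethe_norm p a + y * koethe_norm p b)%:E)%E.
Proof.
move=> Pp x0 y0 uab; rewrite EFinD !EFinM !koethe_normE//.
rewrite /weighted_norm -!nneseriesZl; last 2 first.
- by move=> n _; exact: weighted_ge0 Pp.
- by move=> n _; exact: weighted_ge0 Pp.
rewrite -nneseriesD; last 2 first.
- by move=> n _ _; rewrite mule_ge0 ?lee_fin// -lee_fin (weighted_ge0 _ _ Pp).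
- by move=> n _ _; rewrite mule_ge0 ?lee_fin// -lee_fin (weighted_ge0 _ _ Pp).
apply: lee_nneseries => [n _ _|n _]; first exact: weighted_ge0 Pp.
rewrite -!EFinM -EFinD lee_fin !mulrA -mulrDl ler_wpM2r ?uab//.
exact: weight_ge0 Pp.
Qed.

(* a_n * (b_n + b_(n+1) + ...) + b_n * (a_(n+1) + ...): the sum of a_i * b_j
   over all i, j such that min(i, j) = n *)
Definition koethe_prod_seq a b (n : nat) : R[i] :=
  a n * koethe_tail n b + b n * koethe_tail n.+1 a.

Lemma koethe_prod_seq_bound p a b : weights P p ->
  (weighted_norm p (koethe_prod_seq a b) <=
   (4 * koethe_norm p a * koethe_norm p b)%:E)%E.
Proof.
move=> Pp; apply: le_trans (@koethe_norm_le p _ a b (2 * koethe_norm p b)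
    (2 * koethe_norm p a) Pp _ _ _) _.
- by rewrite mulr_ge0 ?koethe_norm_ge0.
- by rewrite mulr_ge0 ?koethe_norm_ge0.
- move=> n; apply: le_trans (le_normcD _ _) _.
  rewrite !ComplexField.Normc.normcM.
  by apply: lerD; rewrite mulrC ler_wpM2r ?normc_ge0 ?koethe_tail_bound.
- by rewrite lee_fin; lra.
Qed.

Lemma koethe_prod_subproof a b : koethe_prod_seq a b \in koethe_mem P.
Proof.
apply/koethe_memP => p Pp.
by apply: le_lt_trans (koethe_prod_seq_bound a b Pp) _; rewrite ltry.
Qed.

Definition koethe_prod a b : E := Koethe (koethe_prod_subproof a b).

Lemma koethe_prod_bound p a b : weights P p ->
  koethe_norm p (koethe_prod a b) <= 4 * koethe_norm p a * koethe_norm p b.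
Proof.
by move=> Pp; rewrite -lee_fin koethe_normE//; exact: koethe_prod_seq_bound.
Qed.

Lemma koethe_prodDl : left_distributive koethe_prod +%R.
Proof.
move=> a b c; apply/val_inj/funext => n /=.
rewrite -[RHS]/(koethe_prod_seq a c n + koethe_prod_seq b c n).
rewrite /koethe_prod_seq koethe_tailD -[(a + b) n]/(a n + b n).
by ring.
Qed.

Lemma koethe_prodDr : right_distributive koethe_prod +%R.
Proof.
move=> a b c; apply/val_inj/funext => n /=.
rewrite -[RHS]/(koethe_prod_seq a b n + koethe_prod_seq a c n).
rewrite /koethe_prod_seq koethe_tailD -[(b + c) n]/(b n + c n).
by ring.
Qed.

Lemma koethe_prodZl (k : R[i]) a b :
  koethe_prod (k *: a) b = k *: koethe_prod a b.
Proof.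
apply/val_inj/funext => n /=; rewrite -[RHS]/(k * koethe_prod_seq a b n).
rewrite /koethe_prod_seq koethe_tailZ -[(k *: a) n]/(k * a n).
by ring.
Qed.

Lemma koethe_prodZr (k : R[i]) a b :
  koethe_prod a (k *: b) = k *: koethe_prod a b.
Proof.
apply/val_inj/funext => n /=; rewrite -[RHS]/(k * koethe_prod_seq a b n).
rewrite /koethe_prod_seq koethe_tailZ -[(k *: b) n]/(k * b n).
by ring.
Qed.

Lemma finite_koethe_norm_bound (F : set (nat -> R)) a : finite_set F ->
  exists2 M, 0 < M & forall p, F p -> koethe_norm p a <= M.
Proof.
move=> /finite_seqP[s ->].
elim: s => [|q s [M M0 IH]]; first by exists 1.
exists (Num.max M (koethe_norm q a)); first by rewrite lt_max M0.
move=> p /=; rewrite inE => /orP[/eqP->|/IH]; first by rewrite le_max lexx orbT.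
by move=> h; rewrite le_max h.
Qed.

Lemma koethe_prod_continuous :
  continuous (fun ab : E * E => koethe_prod ab.1 ab.2).
Proof.
move=> [a b] U [[F e] [/= Ffin FP e0] abU].
have [A A0 Aa] := finite_koethe_norm_bound a Ffin.
have [B B0 Bb] := finite_koethe_norm_bound b Ffin.
pose da := e / 8 / (B + 1); pose db := Num.min 1 (e / 8 / A).
have da0 : 0 < da by rewrite !divr_gt0// ltr_wpDl// ltW.
have db0 : 0 < db by rewrite lt_min ltr01 !divr_gt0.
exists (koethe_ball a (F, da), koethe_ball b (F, db)).
  by split; [exists (F, da)|exists (F, db)].
move=> [c d] /= [ac bd]; apply: abU => p Fp /=; have Pp := FP _ Fp.
have {ac} /= ac := ac p Fp; have {bd} /= bd := bd p Fp.
have -> : koethe_prod c d - koethe_prod a b =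
    koethe_prod (c - a) d + koethe_prod a (d - b).
  rewrite -[- a]scaleN1r -[- b in RHS]scaleN1r koethe_prodDl koethe_prodDr.
  by rewrite koethe_prodZl koethe_prodZr !scaleN1r addrA subrK.
apply: le_lt_trans (koethe_normD _ _ Pp) _.
have dB : koethe_norm p d <= B + 1.
  rewrite -[d](subrK b); apply: le_trans (koethe_normD _ _ Pp) _.
  rewrite addrC lerD ?Bb//; apply: le_trans (ltW bd) _.
  by rewrite /db ge_min lexx.
rewrite [e]splitr; apply: ltr_leD.
  apply: le_lt_trans (koethe_prod_bound _ _ Pp) _.
  move: ac; rewrite /da ltr_pdivlMr ?ltr_wpDl ?(ltW B0)// => ac.
  have := ler_wpM2l (koethe_norm_ge0 (c - a) Pp) dB.
  by lra.
apply: le_trans (koethe_prod_bound _ _ Pp) _.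
have {}bd : koethe_norm p (d - b) <= e / 8 / A.
  by apply: le_trans (ltW bd) _; rewrite /db ge_min lexx orbT.
move: bd; rewrite ler_pdivlMr// => bd.
have := ler_wpM2l (koethe_norm_ge0 (d - b) Pp) (Aa _ Fp).
by lra.
Qed.

Lemma koethe_unit_subproof (i : nat) : (fun n => (n == i)%:R) \in koethe_mem P.
Proof.
apply/koethe_memP => p Pp; rewrite /weighted_norm (@nneseriesD1 R _ i xpredT)//; last first.
  by move=> n _; exact: (weighted_ge0 (fun n => (n == i)%:R) n Pp).
rewrite eseries0 ?adde0 ?ltry// => n _ /= /negbTE ->.
by rewrite ComplexField.Normc.normc0 mul0r.
Qed.

(* the sequence with 1 in the slot i and 0 elsewhere *)
Definition koethe_unit (i : nat) : E := Koethe (koethe_unit_subproof i).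

Lemma koethe_tail_unit n i : koethe_tail n (koethe_unit i) = (n <= i)%:R.
Proof.
rewrite /koethe_tail /=; case: leqP => [ni|ni].
  rewrite -[RHS](@csum_delta R (i - n)); congr csum; apply/funext => k.
  by rewrite -(eqn_add2l n k) subnKC.
rewrite -[RHS](@csum0 R); congr csum; apply/funext => k.
by rewrite gtn_eqF// (leq_trans ni) ?leq_addr.
Qed.

Lemma koethe_prod_unit i j :
  koethe_prod (koethe_unit i) (koethe_unit j) = koethe_unit (minn i j).
Proof.
apply/val_inj/funext => n /=; rewrite /koethe_prod_seq !koethe_tail_unit /=.
rewrite -!natrM -natrD; congr (_%:R).
by lia.
Qed.

Record is_koethe_product (mul : E -> E -> E) : Prop := IsKoetheProduct {
  koethe_product_Dl : left_distributive mul +%R ;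
  koethe_product_Dr : right_distributive mul +%R ;
  koethe_product_Zl : forall (k : R[i]) a b, mul (k *: a) b = k *: mul a b ;
  koethe_product_Zr : forall (k : R[i]) a b, mul a (k *: b) = k *: mul a b ;
  koethe_product_continuous : continuous (fun ab : E * E => mul ab.1 ab.2) ;
  koethe_product_unit : forall i j,
    mul (koethe_unit i) (koethe_unit j) = koethe_unit (minn i j)
}.

Lemma koethe_prodP : is_koethe_product koethe_prod.
Proof.
split; [exact: koethe_prodDl|exact: koethe_prodDr|exact: koethe_prodZl|
  exact: koethe_prodZr|exact: koethe_prod_continuous|exact: koethe_prod_unit].
Qed.

Lemma koethe_hausdorff : hausdorff_space E.
Proof.
move=> a b ab; apply/val_inj/funext => n /=; apply/eqP/negP => /negP abn.
have [p Pp] := weights_neq0 P.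
have d0 : 0 < normc (a n - b n).
  rewrite lt_neqAle normc_ge0 andbT eq_sym; apply/eqP.
  by move/ComplexField.Normc.eq0_normc/eqP; rewrite subr_eq0 (negbTE abn).
have dle : normc (a n - b n) <= koethe_norm p (a - b).
  apply: le_trans (koethe_partial_le (a - b) n.+1 Pp).
  rewrite big_nat_recr//= ler_wpDl//.
    by apply: sumr_ge0 => k _; rewrite -lee_fin (weighted_ge0 _ _ Pp).
  change (normc (a n - b n) <= normc (a n - b n) * p n); rewrite ler_peMr ?normc_ge0//.
  exact: weights_ge1 Pp _.
pose r := normc (a n - b n) / 2.
have nb (x : E) : nbhs x (koethe_ball x ([set p], r)).
  by exists ([set p], r) => //; split => //= [q ->//|]; exact: divr_gt0.
have [c [ac bc]] := ab _ _ (nb a) (nb b).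
have /= {}ac := ac p erefl; have /= {}bc := bc p erefl.
have : koethe_norm p (a - b) <= koethe_norm p (c - b) + koethe_norm p (c - a).
  rewrite [leRHS]addrC (koethe_distC _ c a).
  by rewrite -[a - b](subrKA c) koethe_normD.
by move: ac bc; rewrite /r; lra.
Qed.

Lemma koethe_cvg (I : Type) (G : set_system I) (f : I -> E) a : Filter G ->
  (forall p (e : R), weights P p -> 0 < e ->
     \forall i \near G, koethe_norm p (f i - a) < e) ->
  f i @[i --> G] --> a.
Proof.
move=> FG H U [[F e] [/= /finite_seqP[s ->] FP e0] aU].
suff : \forall i \near G, koethe_ball a ([set` s], e) (f i).
  by apply: filterS => i; exact: aU.
elim: s FP {aU} => [|q s IH] sP; first by apply: nearW => i p.
have /H Hq : weights P q by apply: sP; rewrite /= mem_head.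
have {}IH : \forall i \near G, koethe_ball a ([set` s], e) (f i).
  by apply: IH => p ps; apply: sP; rewrite /= inE ps orbT.
apply: filterS2 (Hq _ e0) IH => i fq fs p /=.
by rewrite inE => /orP[/eqP->//|ps]; exact: fs.
Qed.

Lemma koethe_partial_cvg a :
  \sum_(0 <= i < N) a i *: koethe_unit i @[N --> \oo] --> a.
Proof.
apply: koethe_cvg => p e Pp e0.
have tailN N : koethe_norm p (\sum_(0 <= i < N) a i *: koethe_unit i - a) =
    fine (\sum_(N <= k <oo) (normc (a k) * p k)%:E)%E.
  congr fine; rewrite /weighted_norm (nneseries_split 0%N N); last first.
    by move=> k _; exact: weighted_ge0 Pp.
  have val_ k : koethe_seq (\sum_(0 <= i < N) a i *: koethe_unit i - a) k =
      if (k < N)%N then 0 else - a k.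
    rewrite -[LHS]/(koethe_seq (\sum_(0 <= i < N) a i *: koethe_unit i) k - a k).
    have -> : koethe_seq (\sum_(0 <= i < N) a i *: koethe_unit i) k =
        if (k < N)%N then a k else 0.
      elim: N => [|N IH]; first by rewrite big_nil.
      rewrite big_nat_recr//=.
      rewrite -[LHS]/(koethe_seq (\sum_(0 <= i < N) a i *: koethe_unit i) k
        + a N * (k == N)%:R) IH.
      have [->|kN] := eqVneq k N; first by rewrite ltnn leqnn mulr1 add0r.
      by rewrite mulr0 addr0 [in RHS]ltnS [in RHS]leq_eqVlt (negbTE kN).
    by case: ifP; rewrite ?subrr ?sub0r.
  rewrite add0n big1_seq ?add0e.
    rewrite [LHS]eseries_cond [RHS]eseries_cond; apply: eq_eseriesr => k.
    by move=> /andP[_ Nk]; rewrite val_ ltnNge Nk /= normcN.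
  move=> k /andP[_]; rewrite mem_index_iota => /andP[_ kN].
  by rewrite val_ kN ComplexField.Normc.normc0 mul0r.
have := @nneseries_tail_cvg R (fun k => (normc (a k) * p k)%:E) xpredT.
move=> /(_ (koethe_norm_lty a Pp)) /(_ (fun k _ => weighted_ge0 a k Pp)).
move=> /fine_cvgP[_] /cvgr0Pnorm_lt /(_ e e0).
by apply: filterS => N; rewrite tailN; apply: le_lt_trans; exact: ler_norm.
Qed.

(* continuous linear maps on λ(P) are determined by the vectors e_i *)
Lemma koethe_linear_ext (f g : E -> E) :
  {morph f : a b / a + b} -> (forall (k : R[i]) a, f (k *: a) = k *: f a) ->
  {morph g : a b / a + b} -> (forall (k : R[i]) a, g (k *: a) = k *: g a) ->
  continuous f -> continuous g ->
  (forall i, f (koethe_unit i) = g (koethe_unit i)) -> f =1 g.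
Proof.
move=> fD fZ gD gZ cf cg fg a.
have cvgf : f (\sum_(0 <= i < N) a i *: koethe_unit i) @[N --> \oo] --> f a.
  exact: continuous_cvg (cf a) (@koethe_partial_cvg a).
have cvgg : g (\sum_(0 <= i < N) a i *: koethe_unit i) @[N --> \oo] --> g a.
  exact: continuous_cvg (cg a) (@koethe_partial_cvg a).
apply: (cvg_unique koethe_hausdorff cvgf).
rewrite (_ : (fun N => _) = fun N => g (\sum_(0 <= i < N) a i *: koethe_unit i))//.
apply/funext => N; elim: N => [|N IH].
  by rewrite big_nil -(scale0r 0) fZ gZ !scale0r.
by rewrite big_nat_recr//= fD gD IH fZ gZ fg.
Qed.

Lemma mul_continuousr (mul : E -> E -> E) a :
  continuous (fun ab : E * E => mul ab.1 ab.2) -> continuous (mul a).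
Proof.
move=> cm b; apply: (@continuous_comp _ _ _ (fun b => (a, b))
  (fun ab : E * E => mul ab.1 ab.2)); last exact: cm.
move=> U [[V W] /= [aV bW] VW]; apply: filterS bW => x Wx.
by apply: (VW (a, x)); split => //; exact: (nbhs_singleton aV).
Qed.

Lemma mul_continuousl (mul : E -> E -> E) b :
  continuous (fun ab : E * E => mul ab.1 ab.2) -> continuous (mul^~ b).
Proof.
move=> cm a; apply: (@continuous_comp _ _ _ (fun a => (a, b))
  (fun ab : E * E => mul ab.1 ab.2)); last exact: cm.
move=> U [[V W] /= [aV bW] VW]; apply: filterS aV => x Vx.
by apply: (VW (x, b)); split => //; exact: (nbhs_singleton bW).
Qed.

Lemma koethe_product_unique mul mul' :
  is_koethe_product mul -> is_koethe_product mul' -> mul = mul'.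
Proof.
move=> [Dl Dr Zl Zr cm mu] [Dl' Dr' Zl' Zr' cm' mu'].
apply/funext => a; apply/funext => b; move: a.
apply: (@koethe_linear_ext (mul^~ b) (mul'^~ b)) => //;
  [exact: mul_continuousl|exact: mul_continuousl|move=> i].
move: b; apply: koethe_linear_ext => //;
  [exact: mul_continuousr|exact: mul_continuousr|move=> j].
by rewrite mu mu'.
Qed.

Lemma koethe_product_exists_unique : exists! mul, is_koethe_product mul.
Proof.
exists koethe_prod; split; first exact: koethe_prodP.
by move=> mul; apply: koethe_product_unique; exact: koethe_prodP.
Qed.

(* the unique continuous product with e_i e_j = e_min(i,j); λ(P) with this
   product is A(P) *)
Definition koethe_mul : E -> E -> E := sval (cid koethe_product_exists_unique).

Lemma koethe_mulP : is_koethe_product koethe_mul.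
Proof. by rewrite /koethe_mul; case: cid => mul []. Qed.

Lemma koethe_mulE a b n :
  koethe_mul a b n = a n * koethe_tail n b + b n * koethe_tail n.+1 a.
Proof.
by rewrite (koethe_product_unique koethe_mulP koethe_prodP).
Qed.

Lemma koethe_mulA : associative koethe_mul.
Proof.
have [Dl Dr Zl Zr cm mu] := koethe_mulP.
have cl b := @mul_continuousl _ b cm; have cr a := @mul_continuousr _ a cm.
move=> a b c; move: a; apply: (@koethe_linear_ext
    (fun a => koethe_mul a (koethe_mul b c))
    (fun a => koethe_mul (koethe_mul a b) c)) => //.
- by move=> a a'; rewrite !Dl.
- by move=> k a; rewrite !Zl.
- by move=> a; apply: (@continuous_comp _ _ _ (koethe_mul^~ b) (koethe_mul^~ c));
    [exact: cl|exact: cl].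
move=> i; move: b; apply: (@koethe_linear_ext
    (fun b => koethe_mul (koethe_unit i) (koethe_mul b c))
    (fun b => koethe_mul (koethe_mul (koethe_unit i) b) c)).
- by move=> b b'; rewrite Dl Dr.
- by move=> k b; rewrite Zl Zr.
- by move=> b b'; rewrite Dr Dl.
- by move=> k b; rewrite Zr Zl.
- by move=> b; apply: (@continuous_comp _ _ _ (koethe_mul^~ c) (koethe_mul _));
    [exact: cl|exact: cr].
- by move=> b; apply: (@continuous_comp _ _ _ (koethe_mul _) (koethe_mul^~ c));
    [exact: cr|exact: cl].
move=> j; move: c; apply: (@koethe_linear_ext
    (fun c => koethe_mul (koethe_unit i) (koethe_mul (koethe_unit j) c))
    (koethe_mul (koethe_mul (koethe_unit i) (koethe_unit j)))) => //.
- by move=> c c'; rewrite !Dr.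
- by move=> k c; rewrite !Zr.
- by move=> c; apply: (@continuous_comp _ _ _ (koethe_mul _) (koethe_mul _));
    [exact: cr|exact: cr].
by move=> k; rewrite !mu minnA.
Qed.

HB.instance Definition _ := TopologicalLmodule_isTopAlgebra.Build R[i] E
  koethe_mulA (koethe_product_Dl koethe_mulP) (koethe_product_Dr koethe_mulP)
  (koethe_product_Zl koethe_mulP) (koethe_product_Zr koethe_mulP)
  (koethe_product_continuous koethe_mulP).

End KoetheProduct.

(* Rows, columns and k start at 1 here, as in the usual notation; the shift to
   the indices of nat takes place in [matrix_weight]. *)
Definition alpha (k i j : nat) : nat := if (i < k)%N then (j ^ k)%N else (i ^ k)%N.

(* n, k and the components of phi_inv n start at 0 and stand for n + 1, k + 1
   and so on; phi_inv is meant to be the inverse of a bijection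
   phi : nat * nat -> nat. *)
Definition matrix_weight (R : realType) (phi_inv : nat -> nat * nat) (k n : nat) : R :=
  (alpha k.+1 (phi_inv n).1.+1 (phi_inv n).2.+1)%:R.

Section MatrixKoetheSet.
Context (R : realType) (phi_inv : nat -> nat * nat).

Lemma matrix_weights_neq0 : range (matrix_weight R phi_inv) !=set0.
Proof. by exists (matrix_weight R phi_inv 0), 0%N. Qed.

Lemma matrix_weights_ge1 p :
  range (matrix_weight R phi_inv) p -> forall n, 1 <= p n.
Proof.
move=> [k _ <-] n; rewrite /matrix_weight /alpha ler1n.
by case: ifP; rewrite expn_gt0.
Qed.

Definition matrix_koethe_set : koethe_set R :=
  KoetheSet matrix_weights_neq0 matrix_weights_ge1.

End MatrixKoetheSet.

(* Main.v *)
Require Import Defs.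
From mathcomp Require Import all_boot all_order all_algebra.
From mathcomp Require Import complex.
From mathcomp Require Import all_classical reals topology normedtype.
From mathcomp Require Import ereal sequences.
From mathcomp Require Import lra.

Set Implicit Arguments.
Unset Strict Implicit.
Unset Printing Implicit Defensive.

(** Since e_n multiplies a finitely supported sequence with support in [0, n]
    trivially, e_n a --> a along every sequence of n on which the weight p_n is
    bounded.  On row m the weights p^(k), k <= m, are bounded, so e_n with n far
    out in that row is a local approximate identity; U only determines m.
    Conversely, if b runs through a bounded approximate identity, then
    e_n b --> e_n forces the tails b_n + b_(n+1) + ... to tend to 1 for each
    fixed n.  But these tails are uniformly small for large n: the rows beyond M
    contribute at most sup |b|_p^(1) / M, and the columns beyond J in the first
    M rows at most sup |b|_p^(M+1) / J. *)

Import Order.TTheory GRing.Theory Num.Theory.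
Import numFieldNormedType.Exports.

Local Open Scope classical_set_scope.
Local Open Scope ring_scope.

Lemma near_forall_finite (T : choiceType) (I : Type) (G : set_system I) (FG : Filter G)
    (F : set T) (Q : T -> I -> Prop) : finite_set F ->
  (forall x, F x -> \forall i \near G, Q x i) ->
  \forall i \near G, forall x, F x -> Q x i.
Proof.
move=> /finite_seqP[s ->].
elim: s => [|x s IH] sQ; first by apply: nearW.
have Qs : \forall i \near G, forall y, [set` s] y -> Q y i.
  by apply: IH => y /= ys; apply: sQ; rewrite /= inE ys orbT.
have Qx : \forall i \near G, Q x i by apply: sQ; rewrite /= mem_head.
by apply: filterS2 Qx Qs => i Qxi Qsi y /=; rewrite inE => /orP[/eqP->//|/Qsi].
Qed.

(** * Approximation by the unit vectors in a general Köthe algebra *)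

Section Koethe.
Context {R : realType} (P : koethe_set R).
Local Notation E := (koethe P).
Implicit Types (a b : E) (p : nat -> R).

Lemma koethe_seqB a b n : (a - b) n = a n - b n.
Proof. by []. Qed.

Lemma normc_le_koethe_norm p a n : weights P p ->
  normc (a n) <= koethe_norm p a.
Proof.
move=> Pp; apply: le_trans (koethe_partial_le a n.+1 Pp).
rewrite big_nat_recr//= ler_wpDl//.
  by apply: sumr_ge0 => k _; rewrite -lee_fin (weighted_ge0 _ _ Pp).
by rewrite ler_peMr ?normc_ge0//; exact: weights_ge1 Pp _.
Qed.

Lemma koethe_norm_unit p n : weights P p -> koethe_norm p (koethe_unit P n) = p n.
Proof.
move=> Pp; rewrite /koethe_norm /weighted_norm.
rewrite (@nneseriesD1 R _ n xpredT)//; last first.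
  by move=> k _; exact: (weighted_ge0 (koethe_unit P n) k Pp).
rewrite eseries0 ?adde0 /= ?eqxx ?ComplexField.Normc.normc1 ?mul1r//.
move=> k _ /= /negbTE ->.
by rewrite ComplexField.Normc.normc0 mul0r.
Qed.

Lemma koethe_mul_bound p a b : weights P p ->
  koethe_norm p (koethe_mul a b) <= 4 * koethe_norm p a * koethe_norm p b.
Proof.
rewrite (koethe_product_unique (koethe_mulP P) (koethe_prodP P)).
exact: koethe_prod_bound.
Qed.

Definition koethe_trunc a N : E := \sum_(0 <= i < N) a i *: koethe_unit P i.

Lemma koethe_truncMr a N n : (N <= n)%N ->
  koethe_mul (koethe_trunc a N) (koethe_unit P n) = koethe_trunc a N.
Proof.
have [Dl _ Zl _ _ mu] := koethe_mulP P.
rewrite /koethe_trunc; elim: N => [|N IH] Nn.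
  by rewrite big_nil -(scale0r 0) Zl !scale0r.
rewrite big_nat_recr//= Dl Zl mu IH ?(ltnW Nn)//.
by rewrite (minn_idPl (ltnW Nn)).
Qed.

Lemma koethe_truncMl a N n : (N <= n)%N ->
  koethe_mul (koethe_unit P n) (koethe_trunc a N) = koethe_trunc a N.
Proof.
have [_ Dr _ Zr _ mu] := koethe_mulP P.
rewrite /koethe_trunc; elim: N => [|N IH] Nn.
  by rewrite big_nil -(scale0r 0) Zr !scale0r.
rewrite big_nat_recr//= Dr Zr mu IH ?(ltnW Nn)//.
by rewrite (minn_idPr (ltnW Nn)).
Qed.

Lemma koethe_trunc_norm_lt p a (e : R) : weights P p -> 0 < e ->
  exists N, koethe_norm p (a - koethe_trunc a N) < e.
Proof.
move=> Pp e0.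
have aU : nbhs a (koethe_ball a ([set p], e)).
  by exists ([set p], e) => //; split => //= q ->.
have [N _ /(_ N (leqnn N)) /= aN] := @koethe_partial_cvg _ P a _ aU.
by exists N; rewrite koethe_distC; exact: aN.
Qed.

(** Once [n] is at least [N], the vector e_n fixes the truncation [c], so only [a - c] enters the
    error, enlarged by a factor of at most [1 + 4 * M]. The bound on [p n] stays inside the filter
    as a premise, because it may hold only along some of the indices. *)
Lemma koethe_mul_unit_near p a (B e : R) : weights P p -> 0 < e ->
  \forall n \near \oo, p n <= B ->
    koethe_norm p (a - koethe_mul a (koethe_unit P n)) < e /\
    koethe_norm p (a - koethe_mul (koethe_unit P n) a) < e.
Proof.
move=> Pp e0; have [Dl Dr _ _ _ _] := koethe_mulP P.
pose M := `|B|; have M0 : 0 <= M by exact: normr_ge0.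
have d0 : 0 < e / (1 + 4 * M) by rewrite divr_gt0//; lra.
have [N] := koethe_trunc_norm_lt a Pp d0.
rewrite ltr_pdivlMr; last by lra.
set c := koethe_trunc a N; set x := koethe_norm p (a - c) => xe.
have x0 : 0 <= x by exact: koethe_norm_ge0.
exists N => // n /= Nn pB.
have uM : koethe_norm p (koethe_unit P n) <= M.
  by rewrite koethe_norm_unit//; exact: le_trans pB (ler_norm B).
have xuM := ler_wpM2l x0 uM.
split.
- have -> : a - koethe_mul a (koethe_unit P n) =
      (a - c) - koethe_mul (a - c) (koethe_unit P n).
    have := Dl (a - c) c (koethe_unit P n); rewrite (koethe_truncMr a Nn) subrK => ->.
    by rewrite opprD addrA addrAC.
  apply: le_lt_trans (koethe_normD _ _ Pp) _; rewrite koethe_normN.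
  have := koethe_mul_bound (a - c) (koethe_unit P n) Pp; rewrite -/x; lra.
- have -> : a - koethe_mul (koethe_unit P n) a =
      (a - c) - koethe_mul (koethe_unit P n) (a - c).
    have := Dr (koethe_unit P n) (a - c) c; rewrite (koethe_truncMl a Nn) subrK => ->.
    by rewrite opprD addrA addrAC.
  apply: le_lt_trans (koethe_normD _ _ Pp) _; rewrite koethe_normN.
  have := koethe_mul_bound (koethe_unit P n) (a - c) Pp; rewrite -/x; lra.
Qed.

(** [B] depends only on the seminorms defining [U], hence so does [C]; the finite set to be
    approximated only decides how far out [n] is taken. *)
Lemma koethe_locally_bounded_approximate_identity :
  (forall F : set (nat -> R), finite_set F -> F `<=` weights P ->
    exists B : R, forall N, exists2 n, (N <= n)%N & forall p, F p -> p n <= B) ->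
  has_locally_bounded_approximate_identity E.
Proof.
move=> bddP U [[F e] [/= Ffin FP e0] FU].
have [B FB] := bddP F Ffin FP.
(* With [M] strictly above every [p n] in question, [C^-1 *: e_n] has norm [p n * e / M < e]. *)
pose M := `|B| + 1; have M0 : 0 < M by rewrite ltr_wpDl.
pose C := ((M / e)%:C)%C : R[i].
have C0 : 0 < C by rewrite ltcR divr_gt0.
exists C => // S Sfin.
have near_S : \forall n \near \oo, forall a, S a -> forall p, F p -> p n <= B ->
    koethe_norm p (a - koethe_mul a (koethe_unit P n)) < e /\
    koethe_norm p (a - koethe_mul (koethe_unit P n) a) < e.
  apply: near_forall_finite => // a _; apply: near_forall_finite => // p Fp.
  exact: koethe_mul_unit_near (FP _ Fp) e0.
have [N _ NS] := near_S.
have [n Nn nB] := FB N.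
have Un (b : E) : (forall p, F p -> koethe_norm p b < e) -> U b.
  by move=> bF; apply: FU => p Fp /=; rewrite subr0; exact: bF.
exists (koethe_unit P n).
  exists (C^-1 *: koethe_unit P n); last by rewrite scalerA divff ?scale1r// gt_eqF.
  apply: Un => p Fp; rewrite koethe_normZ ?koethe_norm_unit; try exact: FP.
  rewrite ComplexField.Normc.normcV.
  have -> : normc C = M / e.
    by rewrite /= expr0n addr0 sqrtr_sqr ger0_norm// divr_ge0// ltW.
  rewrite invf_div mulrAC ltr_pdivrMr// ltr_pM2l//.
  by apply: le_lt_trans (nB _ Fp) _; rewrite /M; have := ler_norm B; lra.
move=> a Sa; have aF := NS n Nn a Sa.
by split; apply: Un => p Fp; have [] := aF p Fp (nB p Fp).
Qed.

(** * Tails of sequences and the obstruction to a bounded approximate identity *)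

Lemma koethe_bounded_norm (B : set E) p : tvs_bounded B -> weights P p ->
  exists2 C : R, 0 <= C & forall b, B b -> koethe_norm p b <= C.
Proof.
move=> bB Pp.
have U0 : nbhs (0 : E) (koethe_ball 0 ([set p], 1)).
  by exists ([set p], 1) => //; split => //= q ->.
have [r _ Br] := bB _ U0; exists (normc r); first exact: normc_ge0.
move=> _ /Br[c /(_ p erefl) /= + <-]; rewrite subr0 => c1.
by rewrite koethe_normZ// ler_piMr ?normc_ge0// ltW.
Qed.

(** Each term of the tail is dominated by its own multiple by [x * p k + y * q k]. The factor 2
    comes from summing real and imaginary parts separately. *)
Lemma koethe_tail_le p q a (x y : R) n : weights P p -> weights P q ->
  0 <= x -> 0 <= y -> (forall k, (n <= k)%N -> 1 <= x * p k + y * q k) ->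
  normc (koethe_tail n a) <= 2 * (x * koethe_norm p a + y * koethe_norm q a).
Proof.
move=> Pp Pq x0 y0 xy; apply: normc_csum => N.
have tail_le r : weights P r ->
    \sum_(0 <= k < N) normc (a (n + k)%N) * r (n + k)%N <= koethe_norm r a.
  move=> Pr; apply: le_trans (koethe_partial_le a (n + N) Pr).
  rewrite [leRHS](big_cat_nat _ (n := n)) ?leq_addr//= ler_wpDl//.
    by apply: sumr_ge0 => k _; rewrite -lee_fin (weighted_ge0 _ _ Pr).
  rewrite -{3}[n]add0n big_addn addKn; apply: ler_sum => k _.
  by rewrite addnC.
apply: le_trans (lerD (ler_wpM2l x0 (tail_le _ Pp)) (ler_wpM2l y0 (tail_le _ Pq))).
rewrite !mulr_sumr -big_split /=; apply: ler_sum => k _.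
have := ler_wpM2l (normc_ge0 (a (n + k)%N)) (xy _ (leq_addr k n)).
by lra.
Qed.

(** Every e_n e_j with j >= n collapses to e_n, so coordinate [n] collects all these
    coefficients. *)
Lemma koethe_unit_mul_diag b n :
  koethe_mul (koethe_unit P n) b n = koethe_tail n b.
Proof. by rewrite koethe_mulE koethe_tail_unit ltnn mulr0 addr0 /= eqxx mul1r. Qed.

(** The order of the quantifiers matters: [x] is tuned to the bound [C] in the norm of [p], then [q]
    is chosen, and only then is the bound [D] in the norm of [q] available for tuning [y]. *)
Lemma koethe_no_bounded_approximate_identity p : weights P p ->
  (forall x : R, 0 < x -> exists2 q, weights P q &
    forall y : R, 0 < y -> exists N,
      forall n, (N <= n)%N -> 1 <= x * p n + y * q n) ->
  ~ has_bounded_approximate_identity E.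
Proof.
move=> Pp small [I [le_ [e [[_ le_refl _ _] be ae]]]].
have [C C0 eC] := koethe_bounded_norm be Pp.
(* The constant 8 makes each of the two contributions at most 1/8, so the tail is at most 2 * (1/8 +
   1/8) = 1/2, while it lies at distance less than 1/2 from 1. The added 1 keeps the denominator
   positive. *)
have x0 : 0 < (8 * (C + 1))^-1 by rewrite invr_gt0; lra.
have [q Pq qN] := small _ x0.
have [D D0 eD] := koethe_bounded_norm be Pq.
have y0 : 0 < (8 * (D + 1))^-1 by rewrite invr_gt0; lra.
have [N xyN] := qN _ y0.
have [+ _] := ae (koethe_unit P N).
have Up : nbhs (koethe_unit P N) (koethe_ball (koethe_unit P N) ([set p], 1 / 2)).
  by exists ([set p], 1 / 2) => //; split => //= q' ->.
move=> /(_ _ Up)[i _ /(_ i (le_refl i)) /(_ p erefl) /= eN].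
have ei : range e (e i) by exists i.
have := le_lt_trans (normc_le_koethe_norm _ N Pp) eN.
rewrite koethe_seqB koethe_unit_mul_diag /= eqxx => tail1.
have tail_small := koethe_tail_le (e i) Pp Pq (ltW x0) (ltW y0) xyN.
have xC : (8 * (C + 1))^-1 * koethe_norm p (e i) <= 1 / 8.
  rewrite mulrC ler_pdivrMr; first by have := eC _ ei; lra.
  by lra.
have yD : (8 * (D + 1))^-1 * koethe_norm q (e i) <= 1 / 8.
  rewrite mulrC ler_pdivrMr; first by have := eD _ ei; lra.
  by lra.
have : normc (1 : R[i]) <= normc (koethe_tail N (e i)) + normc (koethe_tail N (e i) - 1).
  rewrite -[X in _ + X]normcN; apply: le_trans (le_normcD _ _).
  by rewrite opprB subrKC.
by rewrite ComplexField.Normc.normc1; lra.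
Qed.

End Koethe.

(** * Growth of the matrix weights along rows and columns *)

Section MatrixWeights.
Context (R : realType) (phi : nat * nat -> nat) (phi_inv : nat -> nat * nat).
Hypotheses (phiK : cancel phi phi_inv) (phi_invK : cancel phi_inv phi).
Hypothesis phi_incr : forall i j, (phi (i, j) < phi (i, j.+1))%N.

Lemma leq_phi i j : (j <= phi (i, j))%N.
Proof. by elim: j => // j; move/leq_ltn_trans; apply. Qed.

Lemma matrix_weight_row k m j : (k <= m)%N ->
  matrix_weight R phi_inv k (phi (m, j)) = (m.+1 ^ k.+1)%:R.
Proof. by move=> km; rewrite /matrix_weight phiK /alpha ltnS ltnNge km. Qed.

(** Taking the largest index occurring in [F] yields a row [m] on which no weight of [F] depends on
    the column. *)
Lemma finite_matrix_weights (F : set (nat -> R)) : finite_set F ->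
  F `<=` range (matrix_weight R phi_inv) ->
  exists m, forall p, F p ->
    exists2 k, (k <= m)%N & matrix_weight R phi_inv k = p.
Proof.
move=> /finite_seqP[s ->]; elim: s => [|q s IH] sP; first by exists 0%N.
have [m mP] : exists m, forall p, p \in s ->
    exists2 k, (k <= m)%N & matrix_weight R phi_inv k = p.
  by apply: IH => p /= ps; apply: sP; rewrite /= inE ps orbT.
have [l _ lq] : range (matrix_weight R phi_inv) q by apply: sP; rewrite /= mem_head.
exists (maxn l m) => p /=; rewrite inE => /orP[/eqP->|/mP[k km <-]].
  by exists l => //; rewrite leq_maxl.
by exists k => //; rewrite leq_max km orbT.
Qed.

Lemma matrix_weights_bounded (F : set (nat -> R)) : finite_set F ->
  F `<=` range (matrix_weight R phi_inv) ->
  exists B : R, forall N, exists2 n, (N <= n)%N & forall p, F p -> p n <= B.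
Proof.
move=> Ffin FP; have [m mP] := finite_matrix_weights Ffin FP.
exists (m.+1 ^ m.+1)%:R => N; exists (phi (m, N)); first exact: leq_phi.
by move=> _ /mP[k km <-]; rewrite matrix_weight_row// ler_nat leq_pexp2l.
Qed.

(** The [M] by [J] rectangle is finite, so its image under [phi] has a maximum; [N] is the successor
    of it. *)
Lemma row_or_column_large M J : exists N, forall n, (N <= n)%N ->
  (M <= (phi_inv n).1)%N \/
  ((phi_inv n).1 < M)%N /\ (J <= (phi_inv n).2)%N.
Proof.
exists (\max_(i < M) \max_(j < J) phi (i : nat, j : nat)).+1 => n.
rewrite -{1}[n]phi_invK; case: (phi_inv n) => i j /= Nn.
have [|iM] := leqP M i; first by left.
right; split=> //; rewrite leqNgt; apply/negP => jJ; move: Nn; rewrite ltnNge.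
have := leq_bigmax (F := fun i : 'I_M => \max_(j < J) phi (i : nat, j : nat))
  (Ordinal iM).
have := leq_bigmax (F := fun j : 'I_J => phi (i, j : nat)) (Ordinal jJ).
by move=> /= /leq_trans h /h ->.
Qed.

(** The weight of index 0 is the row number, counted from 1, so it handles the rows from [M] on. In
    the first [M] rows the weight of index [M] is a positive power of the column number and handles
    the columns from [J] on. [M] depends on [x] alone, which lets [q] precede [y]. *)
Lemma matrix_weights_large (x : R) : 0 < x ->
  exists2 q, range (matrix_weight R phi_inv) q &
  forall y : R, 0 < y -> exists N, forall n, (N <= n)%N ->
    1 <= x * matrix_weight R phi_inv 0 n + y * q n.
Proof.
have bound (z : R) (m l : nat) :
    0 < z -> z^-1 < m%:R -> (m <= l)%N -> 1 <= z * l%:R.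
  move=> z0 zm ml; rewrite -ler_pdivrMl// mulr1 (le_trans (ltW zm))//.
  by rewrite ler_nat.
move=> x0; pose M := Num.bound x^-1.
exists (matrix_weight R phi_inv M); first by exists M.
move=> y y0; pose J := Num.bound y^-1.
have xM : x^-1 < M%:R by rewrite archi_boundP// invr_ge0 ltW.
have yJ : y^-1 < J%:R by rewrite archi_boundP// invr_ge0 ltW.
have [N MJ] := row_or_column_large M J.
exists N => n /MJ[iM|[iM jJ]]; rewrite /matrix_weight /alpha.
- rewrite ler_wpDr ?mulr_ge0 ?ler0n ?(ltW y0)//= expn1.
  exact: bound x0 xM (leqW iM).
- rewrite ler_wpDl ?mulr_ge0 ?ler0n ?(ltW x0)// ltnS iM.
  apply: bound y0 yJ _; apply: leq_trans (leqW jJ) _.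
  by rewrite -{1}[_.+1]expn1 leq_pexp2l.
Qed.

End MatrixWeights.

Theorem proposition10p4 (R : realType)
    (phi : nat * nat -> nat) (phi_inv : nat -> nat * nat)
    (phiK : cancel phi phi_inv) (phi_invK : cancel phi_inv phi)
    (phi_incr : forall i j : nat, (phi (i, j) < phi (i, j.+1))%N) :
  has_locally_bounded_approximate_identity
    (koethe (matrix_koethe_set R phi_inv)) /\
  ~ has_bounded_approximate_identity
    (koethe (matrix_koethe_set R phi_inv)).
Proof.
split.
  apply: koethe_locally_bounded_approximate_identity => F Ffin FP.
  exact: (matrix_weights_bounded phiK phi_incr Ffin FP).
apply: (@koethe_no_bounded_approximate_identity _ _ (matrix_weight R phi_inv 0)).
  by exists 0%N.
by move=> x x0; exact: (matrix_weights_large phi_invK x0).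
Qed.
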